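(* For every $n\ge3$, the identity problem for finitely generated matrix semigroups in ${\rm H}(n,\mathbb{Q})$ is decidable: given a finite set $G\subseteq{\rm H}(n,\mathbb{Q})$, it is decidable whether the identity matrix $I_n$ belongs to the semigroup generated by $G$.
   Context: ${\rm H}(n,\mathbb{Q})$ is the group of $n\times n$ matrices $\begin{pmatrix}1&\mathbf a^{\mathsf T}&c\\0&I_{n-2}&\mathbf b\\0&0&1\end{pmatrix}$ with $\mathbf a,\mathbf b\in\mathbb{Q}^{n-2}$, $c\in\mathbb{Q}$. The semigroup generated by $G$ is the set of all finite nonempty products of elements of $G$. *)

(* Defs.v *)
From mathcomp Require Import all_boot all_order all_algebra.

Set Implicit Arguments.
Unset Strict Implicit.
Unset Printing Implicit Defensive.

Import GRing.Theory.

(* The total recursive functions of several natural number variables: the     *)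
(* least class containing the zero, successor and projection functions and    *)
(* closed under composition, primitive recursion and minimization of regular  *)
(* functions.  The last three rules describe their conclusion by defining     *)
(* equations, so the class is closed under pointwise equality.                *)
(* In rec_min, the existence of g says that f is regular: for every v there   *)
(* is y such that f (y, v) = 0; g v is the least such y.                      *)
Inductive recursive : forall n : nat, (n.-tuple nat -> nat) -> Prop :=
| rec_zero n : @recursive n (fun=> 0)
| rec_succ : @recursive 1 (fun v => (tnth v ord0).+1)
| rec_proj n (i : 'I_n) : @recursive n (fun v => tnth v i)
| rec_comp m n (f : m.-tuple nat -> nat) (h : 'I_m -> n.-tuple nat -> nat)
    (g : n.-tuple nat -> nat) :
    recursive f -> (forall i, recursive (h i)) ->
    (forall v, g v = f [tuple h i v | i < m]) ->
    recursive g
| rec_prim n (f : n.-tuple nat -> nat) (h : n.+2.-tuple nat -> nat)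
    (g : n.+1.-tuple nat -> nat) :
    recursive f -> recursive h ->
    (forall v : n.-tuple nat, g [tuple of 0 :: v] = f v) ->
    (forall (v : n.-tuple nat) (k : nat),
       g [tuple of k.+1 :: v] = h [tuple of k :: g [tuple of k :: v] :: v]) ->
    recursive g
| rec_min n (f : n.+1.-tuple nat -> nat) (g : n.-tuple nat -> nat) :
    recursive f ->
    (forall v : n.-tuple nat, f [tuple of g v :: v] = 0) ->
    (forall (v : n.-tuple nat) (y : nat),
       y < g v -> f [tuple of y :: v] <> 0) ->
    recursive g.

(* A decision problem consists of instances x : T such that D x, presented to *)
(* the algorithm through their code in nat; the algorithm outputs 1 on the    *)
(* instances satisfying P and 0 on the others.  Nothing is required on        *)
(* numbers that are not the code of an instance.                              *)
Definition decidable_problem (T : Type) (code : T -> nat) (D P : T -> Prop) :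
    Prop :=
  exists f : 1.-tuple nat -> nat,
    recursive f /\
    forall x : T, D x ->
      (P x -> f [tuple code x] = 1) /\ (~ P x -> f [tuple code x] = 0).

Definition int_code (z : int) : nat :=
  match z with Posz k => k.*2 | Negz k => k.*2.+1 end.

Definition rat_code (q : rat) : nat :=
  CodeSeq.code [:: int_code (numq q); int_code (denq q)].

(* Entries are listed row by row. *)
Definition mx_code (n : nat) (A : 'M[rat]_n) : nat :=
  CodeSeq.code [seq rat_code (A i j) | i <- enum 'I_n, j <- enum 'I_n].

Definition mxs_code (n : nat) (G : seq 'M[rat]_n) : nat :=
  CodeSeq.code [seq mx_code A | A <- G].

Local Open Scope ring_scope.

(* For 2 <= n, castmx only transports the block matrix along the equality     *)
(* 1 + (n - 2 + 1) = n.                                                       *)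
Definition heisenberg (n : nat) (A : 'M[rat]_n) : Prop :=
  exists (e : (1 + (n - 2 + 1))%N = n) (a b : 'cV[rat]_(n - 2)) (c : rat),
    A = castmx (e, e)
          (block_mx 1%:M (row_mx a^T c%:M)
                    0    (block_mx 1%:M b
                                   0    1%:M)).

Definition in_semigroup (n : nat) (G : seq 'M[rat]_n) (A : 'M[rat]_n) : Prop :=
  exists s : seq 'M[rat]_n,
    [/\ s != [::], {subset s <= G} & A = \big[mulmx/1%:M]_(B <- s) B].

(* An algorithm receives a finite set G as a list of its elements; the order  *)
(* is arbitrary and repetitions are allowed.                                  *)
Definition identity_problem_decidable (n : nat) : Prop :=
  decidable_problem (@mxs_code n)
    (fun G => forall A, A \in G -> heisenberg A)
    (fun G => in_semigroup G 1%:M).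

(* Main.v *)
Require Import Defs.
From mathcomp Require Import all_boot all_order all_algebra.
From mathcomp Require Import zify ring lra.

(* Write an element of the Heisenberg group as (u, c) with u = (a, b), and    *)
(* let log (u, c) = c - a.b / 2 and om (u, u') = a.b' - a'.b.  On commuting   *)
(* elements, those with om = 0, both u and log are additive.  Suppose that a  *)
(* multiset of generators has total u equal to zero.  If it contains two      *)
(* generators that do not commute, then exchanging a block of k copies of one *)
(* with a block of k copies of the other changes the central entry by a term  *)
(* quadratic in k, so that central elements of both signs, hence also the     *)
(* identity, are reached.  If it is commutative, all its products have the    *)
(* same central entry, the sum of the logs.  Therefore the identity is        *)
(* reached iff sum x_s u_s = 0 has a solution x in N^k which either satisfies *)
(* also sum x_s log_s = 0 with x nonzero, or has two noncommuting generators  *)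
(* in its support.  Whether a given index lies in the support of a solution   *)
(* of x M = 0 is decided by an unbounded search for either such an x or a     *)
(* vector y with M y >= 0 and (M y)_i > 0; by Farkas' lemma it terminates.    *)

(** The proof joins a group-theoretic criterion, [identity_wordP], to a decision procedure for
    linear systems over the natural numbers, [supported_decidable]. Solutions of a homogeneous
    system can be added, so two generators lie in the support of one common solution iff each lies
    in the support of some solution. The criterion thus becomes a finite Boolean combination of
    questions about the support of a single index, together with the test that two given generators
    do not commute.

    The difficult direction of the criterion is [twist], which builds the identity from a
    noncommuting pair by means of [hlog_mul]. The procedure relies on [farkas], which guarantees
    that a certificate exists on one side, and on [farkas_exclusive], which forbids certificates on
    both sides. The algorithm has to be a [recursive] function on codes, so every ingredient is also
    shown to be computable, with exact rational arithmetic expressed by natural numbers. *)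

Set Implicit Arguments.
Unset Strict Implicit.
Unset Printing Implicit Defensive.

Import Order.TTheory GRing.Theory Num.Theory.

(** * Recursive functions *)

(* Functions of any number of arguments at once; missing arguments are read   *)
(* as 0.                                                                      *)
Definition recf (f : seq nat -> nat) : Prop :=
  forall n, recursive (fun v : n.-tuple nat => f v).

Lemma recursive_ext n (f g : n.-tuple nat -> nat) :
  recursive f -> f =1 g -> recursive g.
Proof.
move=> rf fg; apply: (@rec_comp _ _ f (fun i v => tnth v i)) => // [i|v].
  exact: rec_proj.
by rewrite -fg; congr f; apply: eq_from_tnth => i; rewrite tnth_mktuple.
Qed.

Lemma recf_ext f g : recf f -> f =1 g -> recf g.
Proof. by move=> rf fg n; apply: recursive_ext (rf n) _ => v; apply: fg. Qed.

Lemma recf_nth i : recf (fun v => nth 0 v i).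
Proof.
move=> n; have [lt_in|le_ni] := ltnP i n.
  apply: recursive_ext (rec_proj (Ordinal lt_in)) _ => v.
  by rewrite (tnth_nth 0).
apply: recursive_ext (rec_zero n) _ => v.
by rewrite nth_default // size_tuple.
Qed.

(** The length of [h v] depends only on that of [v], so for each arity a composition with [h] uses a
    fixed number of inner functions, as [rec_comp] demands. *)
Definition recs (h : seq nat -> seq nat) : Prop :=
  (exists sz : nat -> nat, forall v, size (h v) = sz (size v)) /\
  (forall i, recf (fun v => nth 0 (h v) i)).

Lemma recf_comp f h : recf f -> recs h -> recf (fun v => f (h v)).
Proof.
move=> rf [[sz hsz] rh] n.
apply: (@rec_comp (sz n) n (fun v => f v)
          (fun i v => nth 0 (h v) (nat_of_ord i))) => [|i|v].
- exact: rf.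
- exact: rh.
congr f; have szv : size (h v) = sz n by rewrite hsz size_tuple.
apply: (@eq_from_nth _ 0) => [|i]; first by rewrite size_tuple.
rewrite szv => lt_i.
by have := tnth_mktuple (fun i : 'I_(sz n) => nth 0 (h v) i) (Ordinal lt_i);
   rewrite (tnth_nth 0) => ->.
Qed.

Lemma recs_id : recs (fun v => v).
Proof. by split=> [|i]; [exists id | apply: recf_nth]. Qed.

Lemma recs_behead h : recs h -> recs (fun v => behead (h v)).
Proof.
move=> [[sz hsz] rh]; split=> [|i].
  by exists (fun n => (sz n).-1) => v; rewrite size_behead hsz.
by apply: recf_ext (rh i.+1) _ => v; rewrite nth_behead.
Qed.

Lemma recs_cons f h : recf f -> recs h -> recs (fun v => f v :: h v).
Proof.
move=> rf [[sz hsz] rh]; split=> [|[|i]] //.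
  by exists (fun n => (sz n).+1) => v /=; rewrite hsz.
exact: rh.
Qed.

Lemma recs_nil : recs (fun=> [::]).
Proof.
split=> [|i]; first by exists (fun=> 0).
by move=> n; apply: recursive_ext (rec_zero n) _ => v; rewrite nth_nil.
Qed.

Lemma recf_at h i : recs h -> recf (fun v => nth 0 (h v) i).
Proof. by case. Qed.

Lemma recf_head h : recs h -> recf (fun v => head 0 (h v)).
Proof. by move=> rh; apply: recf_ext (recf_at 0 rh) _ => v; rewrite nth0. Qed.

Lemma recf_const c : recf (fun=> c).
Proof.
elim: c => [|c IHc] n; first exact: rec_zero.
apply: (@rec_comp 1 n _ (fun _ _ => c) _ (rec_succ)) => [i|v].
  exact: IHc.
by congr S; rewrite tnth_mktuple.
Qed.

Lemma recf_succ f : recf f -> recf (fun v => (f v).+1).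
Proof.
move=> rf n; apply: (@rec_comp 1 n _ (fun _ (v : n.-tuple nat) => f v)).
- exact: rec_succ.
- by move=> _; apply: rf.
- by move=> v /=; rewrite tnth_mktuple.
Qed.

Lemma recf_prim (a b : seq nat -> nat) (F : nat -> nat -> seq nat -> nat) :
    recf a -> recf b ->
    recf (fun w => F (head 0 w) (head 0 (behead w)) (behead (behead w))) ->
  recf (fun v => nat_rect (fun=> nat) (a v) (fun k r => F k r v) (b v)).
Proof.
move=> ra rb rF.
pose g w := nat_rect (fun=> nat) (a (behead w))
                     (fun k r => F k r (behead w)) (head 0 w).
have rg : recf g.
  (* [rec_prim] defines functions of at least one argument; without arguments [g] is a constant. *)
  case=> [|n].
    apply: recursive_ext (recf_const (g [::]) 0) _ => v.
    by rewrite (tuple0 v).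
  apply: (@rec_prim n (fun v => a v) (fun v : n.+2.-tuple nat =>
           F (head 0 v) (head 0 (behead v)) (behead (behead v)))
           _ (ra n) (rF n.+2)) => //.
apply: recf_ext (recf_comp rg (recs_cons rb recs_id)) _ => v.
by rewrite /g.
Qed.

(** Computability of an operation is stated as closure of [recf] under it, so that proof search can
    follow the syntax of a compound expression. *)
Notation rec1 op := (forall f, recf f -> recf (fun v => op (f v))).
Notation rec2 op :=
  (forall f g, recf f -> recf g -> recf (fun v => op (f v) (g v))).
Lemma rec1I op : recf (fun w => op (head 0 w)) -> rec1 op.
Proof.
by move=> rop f rf; apply: recf_ext (recf_comp rop (recs_cons rf recs_nil)) _.
Qed.

Lemma recf_iter (a b : seq nat -> nat) (F : nat -> nat) :
  rec1 F -> recf a -> recf b -> recf (fun v => iter (b v) F (a v)).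
Proof.
move=> rF ra rb.
apply: recf_ext (recf_prim (F := fun _ r _ => F r) ra rb _) _ => [|v].
  exact/rF/recf_head/recs_behead/recs_id.
by elim: (b v) => //= k ->.
Qed.

Lemma recf_add : rec2 addn.
Proof.
move=> f g rf rg; apply: recf_ext (recf_iter (F := S) _ rg rf) _ => [|v].
  exact: recf_succ.
by elim: (f v) => //= k ->.
Qed.

Lemma recf_mul : rec2 muln.
Proof.
move=> f g rf rg.
apply: recf_ext
  (recf_prim (F := fun _ r v => g v + r) (recf_const 0) rf _) _ => [|v].
  apply: recf_add; first exact/(recf_comp rg)/recs_behead/recs_behead/recs_id.
  exact/recf_head/recs_behead/recs_id.
by elim: (f v) => //= k ->; rewrite mulSn.
Qed.

Lemma recf_pred : rec1 predn.
Proof.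
apply: rec1I.
apply: recf_ext (recf_prim (F := fun k _ _ => k)
  (recf_const 0) (recf_head recs_id) (recf_head recs_id)) _ => v.
by case: (head 0 v).
Qed.

Lemma recf_sub : rec2 subn.
Proof.
move=> f g rf rg.
apply: recf_ext (recf_iter recf_pred rf rg) _ => v.
by elim: (g v) => [|k IHk]; rewrite ?subn0 //= IHk subnS.
Qed.

Lemma recf_exp : rec2 expn.
Proof.
move=> f g rf rg.
apply: recf_ext
  (recf_prim (F := fun _ r v => f v * r) (recf_const 1) rg _) _ => [|v].
  apply: recf_mul; first exact/(recf_comp rf)/recs_behead/recs_behead/recs_id.
  exact/recf_head/recs_behead/recs_id.
by elim: (g v) => //= k ->; rewrite expnS.
Qed.

Lemma recf_big (op : nat -> nat -> nat) (x0 : nat)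
    (F : nat -> seq nat -> nat) (b : seq nat -> nat) :
    rec2 op -> (forall G n,
      \big[op/x0]_(0 <= i < n.+1) G i =
      op (\big[op/x0]_(0 <= i < n) G i) (G n)) ->
    recf b -> recf (fun w => F (head 0 w) (behead w)) ->
  recf (fun v => \big[op/x0]_(0 <= i < b v) F i v).
Proof.
move=> rop opE rb rF.
apply: recf_ext
  (recf_prim (F := fun k r v => op r (F k v)) (recf_const x0) rb _) _ => [|v].
  apply: rop; first exact/recf_head/recs_behead/recs_id.
  apply: (recf_comp (h := fun w => head 0 w :: behead (behead w)) rF).
  apply: recs_cons; first exact/recf_head/recs_id.
  exact/recs_behead/recs_behead/recs_id.
elim: (b v) => [|k /= ->]; first by rewrite big_geq.
by rewrite opE.
Qed.

Lemma recf_sum (F : nat -> seq nat -> nat) (b : seq nat -> nat) :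
    recf b -> recf (fun w => F (head 0 w) (behead w)) ->
  recf (fun v => \sum_(0 <= i < b v) F i v).
Proof. by apply: recf_big recf_add _ => G n; rewrite big_nat_recr. Qed.

Lemma recf_prod (F : nat -> seq nat -> nat) (b : seq nat -> nat) :
    recf b -> recf (fun w => F (head 0 w) (behead w)) ->
  recf (fun v => \prod_(0 <= i < b v) F i v).
Proof. by apply: recf_big recf_mul _ => G n; rewrite big_nat_recr. Qed.

Definition recb (P : seq nat -> bool) : Prop := recf (fun v => P v).

Lemma recb_ext P Q : recb P -> P =1 Q -> recb Q.
Proof. by move=> rP PQ; apply: recf_ext rP _ => v; rewrite PQ. Qed.

Lemma recb_comp P h : recb P -> recs h -> recb (fun v => P (h v)).
Proof. exact: recf_comp. Qed.

Lemma recb_not P : recb P -> recb (fun v => ~~ P v).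
Proof.
move=> rP; apply: recf_ext (recf_sub (recf_const 1) rP) _ => v.
by case: (P v).
Qed.

Lemma recb_and P Q : recb P -> recb Q -> recb (fun v => P v && Q v).
Proof.
move=> rP rQ; apply: recf_ext (recf_mul rP rQ) _ => v.
by rewrite mulnb.
Qed.

Lemma recb_or P Q : recb P -> recb Q -> recb (fun v => P v || Q v).
Proof.
move=> rP rQ; apply: recb_ext
  (recb_not (recb_and (recb_not rP) (recb_not rQ))) _ => v.
by rewrite negb_and !negbK.
Qed.

Lemma recf_if P f g :
  recb P -> recf f -> recf g -> recf (fun v => if P v then f v else g v).
Proof.
move=> rP rf rg.
apply: recf_ext (recf_add (recf_mul rP rf) (recf_mul (recb_not rP) rg)) _ => v.
by case: (P v); rewrite ?mul1n ?mul0n ?addn0.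
Qed.

Lemma recb_leq f g : recf f -> recf g -> recb (fun v => f v <= g v).
Proof.
move=> rf rg; apply: recf_ext
  (recf_sub (recf_const 1) (recf_sub rf rg)) _ => v.
by rewrite /leq; case: (f v - g v).
Qed.

Lemma recb_eq f g : recf f -> recf g -> recb (fun v => f v == g v).
Proof.
move=> rf rg; apply: recb_ext
  (recb_and (recb_leq rf rg) (recb_leq rg rf)) _ => v.
by rewrite eqn_leq.
Qed.

Lemma recb_all (P : nat -> seq nat -> bool) b :
    recf b -> recb (fun w => P (head 0 w) (behead w)) ->
  recb (fun v => all (fun i => P i v) (iota 0 (b v))).
Proof.
move=> rb rP.
apply: recb_ext (recb_eq (recf_sum (F := fun i v => ~~ P i v) rb
  (recb_not rP)) (recf_const 0)) _ => v.
rewrite sum_nat_seq_eq0 /= /index_iota subn0.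
by apply: eq_all => i /=; case: (P i v).
Qed.

Lemma recb_has (P : nat -> seq nat -> bool) b :
    recf b -> recb (fun w => P (head 0 w) (behead w)) ->
  recb (fun v => has (fun i => P i v) (iota 0 (b v))).
Proof.
move=> rb rP.
apply: recb_ext (recb_not (recb_all (P := fun i v => ~~ P i v) rb
  (recb_not rP))) _ => v.
by rewrite -has_predC; apply: eq_has => i /=; rewrite negbK.
Qed.

(** Bounded search as a sum: in the sum of [k * (k == g v)] over [k < b v] only the term [k = g v]
    survives. This inverts coding functions, given a test for their graph. *)
Lemma recf_graph (g b : seq nat -> nat) :
    (forall v, g v < b v) -> recf b ->
    recb (fun w => head 0 w == g (behead w)) ->
  recf g.
Proof.
move=> lt_gb rb rg.
apply: recf_ext (recf_sum (F := fun k v => k * (k == g v)) rb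
  (recf_mul (recf_head recs_id) rg)) _ => v.
rewrite (bigD1_seq (g v)) ?iota_uniq ?mem_index_iota ?lt_gb //=.
rewrite eqxx muln1 big1 ?addn0 // => i /negPf ->; exact: muln0.
Qed.

(** Unbounded search. The existence of a witness for every argument is the regularity that [rec_min]
    asks of the function to be minimized, here the negation of [P], whose zeros are the
    witnesses. *)
Lemma recf_search (P : nat -> seq nat -> bool) :
    (forall v, exists y, P y v) ->
    recb (fun w => P (head 0 w) (behead w)) ->
  exists g, recf g /\ forall v, P (g v) v.
Proof.
move=> exP rP; exists (fun v => ex_minn (exP v)).
split=> [n|v]; last by case: ex_minnP.
apply: (@rec_min n (fun w => ~~ P (head 0 w) (behead w))).
- exact: (recb_not rP).
- by move=> v /=; case: ex_minnP => y ->.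
- move=> v y /=; case: ex_minnP => z _ minz; rewrite ltnNge.
  by case: (boolP (P y v)) => // /minz ->.
Qed.

Create HintDb rec.
#[local] Hint Resolve recf_nth recf_at recf_head recf_const recf_succ recf_add
  recf_mul recf_pred recf_sub recf_exp recf_sum recf_prod recb_not recb_and
  recb_or recf_if recb_leq recb_eq recb_all recb_has
  recs_id recs_behead recs_cons recs_nil : rec.
Ltac recur := solve [cbn beta; eauto 100 with rec nocore].

(** * Decoding lists of natural numbers *)

Lemma cons_codeE c : 0 < c ->
  c = 2 ^ head 0 (CodeSeq.decode c) *
        (CodeSeq.code (behead (CodeSeq.decode c))).*2.+1.
Proof.
rewrite -{1 2}(CodeSeq.decodeK c).
by case: (CodeSeq.decode c).
Qed.

Lemma decode_cons c k m : c = 2 ^ k * m.*2.+1 ->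
  CodeSeq.decode c = k :: CodeSeq.decode m.
Proof.
move=> ->; rewrite -{1}(CodeSeq.decodeK m).
by rewrite -[LHS]/(CodeSeq.decode (CodeSeq.code (k :: _))) CodeSeq.codeK.
Qed.

Lemma recf_hd : rec1 (fun c => head 0 (CodeSeq.decode c)).
Proof.
apply: rec1I; apply: (@recf_graph _ (fun w => (head 0 w).+1)) => [v||].
- case: (posnP (head 0 v)) => [->|] // /cons_codeE {2}->.
  rewrite ltnS; apply: leq_trans (leq_pmulr _ _) => //.
  exact/ltnW/ltn_expl.
- by recur.
(* The code 0 is the empty list; any other code is uniquely a power of two, whose exponent is the
   head, times an odd number [2m+1], where [m] codes the tail. *)
apply: (@recb_ext (fun w =>
  (head 0 (behead w) == 0) && (head 0 w == 0) ||
  has (fun m => head 0 (behead w) == 2 ^ head 0 w * (m + m).+1)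
    (iota 0 (head 0 (behead w))))).
  by recur.
move=> w; set k := head 0 w; set c := head 0 (behead w).
apply/idP/eqP => [/orP[/andP[/eqP-> /eqP->] //|]|->].
  by case/hasP=> m _ /eqP; rewrite addnn => /decode_cons ->.
have [->|c_gt0] := posnP c; first by [].
apply/orP; right; apply/hasP; have cE := cons_codeE c_gt0.
exists (CodeSeq.code (behead (CodeSeq.decode c))); last by rewrite addnn -cE.
rewrite mem_iota /= add0n [ltnRHS]cE.
apply: leq_trans (leq_pmull _ _); last by rewrite expn_gt0.
by rewrite ltnS -addnn leq_addr.
Qed.

Lemma recf_tl : rec1 (fun c => CodeSeq.code (behead (CodeSeq.decode c))).
Proof.
apply: rec1I; apply: (@recf_graph _ (fun w => (head 0 w).+1)) => [v||].
- case: (posnP (head 0 v)) => [->|] // /cons_codeE {2}->.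
  rewrite ltnS; apply: leq_trans (leq_pmull _ _); last by rewrite expn_gt0.
  by rewrite -addnn -addnS leq_addr.
- by recur.
apply: (@recb_ext (fun w =>
  (head 0 (behead w) == 0) && (head 0 w == 0) ||
  has (fun k => head 0 (behead w) == 2 ^ k * (head 0 w + head 0 w).+1)
    (iota 0 (head 0 (behead w))))).
  by recur.
move=> w; set m := head 0 w; set c := head 0 (behead w).
apply/idP/eqP => [/orP[/andP[/eqP-> /eqP->] //|]|->].
  case/hasP=> k _ /eqP; rewrite addnn => /decode_cons -> /=.
  by rewrite CodeSeq.decodeK.
have [->|c_gt0] := posnP c; first by [].
apply/orP; right; apply/hasP; have cE := cons_codeE c_gt0.
exists (head 0 (CodeSeq.decode c)); last by rewrite addnn -cE.
rewrite mem_iota /= add0n [ltnRHS]cE.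
by apply: leq_trans (ltn_expl _ _) (leq_pmulr _ _).
Qed.

Definition cnth (c i : nat) : nat := nth 0 (CodeSeq.decode c) i.
Definition csize (c : nat) : nat := size (CodeSeq.decode c).

Lemma recf_cdrop :
  rec2 (fun c i => CodeSeq.code (drop i (CodeSeq.decode c))).
Proof.
move=> f g rf rg; apply: recf_ext (recf_iter recf_tl rf rg) _ => v.
elim: (g v) => [|k IHk] /=; first by rewrite drop0 CodeSeq.decodeK.
by rewrite IHk CodeSeq.codeK -drop1 drop_drop.
Qed.

Lemma recf_cnth : rec2 cnth.
Proof.
move=> f g rf rg; apply: recf_ext (recf_hd (recf_cdrop rf rg)) _ => v.
by rewrite CodeSeq.codeK -nth0 nth_drop addn0.
Qed.

Lemma size_le_code s : size s <= CodeSeq.code s.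
Proof.
elim: s => //= x s IHs; apply: leq_trans (leq_pmull _ _).
  by rewrite ltnS (leq_trans IHs) // -addnn leq_addr.
by rewrite expn_gt0.
Qed.

(** The length of a list is the number of [i] such that dropping [i] elements leaves a nonzero code;
    by [size_le_code] it suffices to let [i] run below the code itself. *)
Lemma recf_csize : rec1 csize.
Proof.
apply: rec1I.
have rcdrop := recf_cdrop.
apply: recf_ext (recf_sum (F := fun i w =>
  0 < CodeSeq.code (drop i (CodeSeq.decode (head 0 w))))
  (recf_head recs_id) _) _ => [|w].
  by recur.
rewrite /csize -[X in index_iota 0 X](CodeSeq.decodeK (head 0 w)).
set s := CodeSeq.decode _.
rewrite (big_cat_nat (n := size s)) ?size_le_code //=.
rewrite [X in _ + X]big1_seq ?addn0 => [|i]; last first.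
  by rewrite /= mem_index_iota => /andP[le_i _]; rewrite drop_oversize.
rewrite -[RHS]subn0 -[RHS]muln1.
rewrite -sum_nat_const_nat; apply: eq_big_nat => i lt_i.
by rewrite (drop_nth 0) //= muln_gt0 expn_gt0.
Qed.

Lemma recf_double : rec1 double.
Proof.
by move=> f rf; apply: recf_ext (recf_add rf rf) _ => v; rewrite addnn.
Qed.
#[local] Hint Resolve recf_double : rec.

Lemma recf_half : rec1 half.
Proof.
apply: rec1I; apply: (@recf_graph _ (fun w => (head 0 w).+1)) => [v||].
- by lia.
- by recur.
apply: (@recb_ext (fun w => (head 0 (behead w) == (head 0 w).*2) ||
                            (head 0 (behead w) == (head 0 w).*2.+1))).
  by recur.
by move=> w; lia.
Qed.
#[local] Hint Resolve recf_half : rec.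

Lemma recf_odd : rec1 odd.
Proof.
move=> f rf.
apply: recf_ext (recf_sub rf (recf_double (recf_half rf))) _ => v.
lia.
Qed.

Lemma recb_odd f : recf f -> recb (fun v => odd (f v)).
Proof. exact: recf_odd. Qed.

#[local] Hint Resolve recb_odd recf_cnth recf_csize : rec.

(** * Rational arithmetic *)

(** Values are differences of naturals over a positive natural, not necessarily reduced: ring
    operations are then polynomial in the representatives, and a sign test compares [p] with [q]. *)
Definition recq (f : seq nat -> rat) : Prop :=
  exists p q d : seq nat -> nat, [/\ recf p, recf q, recf d,
    forall v, (0 < d v)%N &
    forall v, (f v = ((p v)%:R - (q v)%:R) / (d v)%:R)%R].

Lemma recq_ext f g : recq f -> f =1 g -> recq g.
Proof.
case=> p [q [d [rp rq rd d0 fE]]] fg; exists p, q, d; split=> // v.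
by rewrite -fg fE.
Qed.

Lemma recq_comp f h : recq f -> recs h -> recq (fun v => f (h v)).
Proof.
case=> p [q [d [rp rq rd d0 fE]]] rh.
exists (fun v => p (h v)), (fun v => q (h v)), (fun v => d (h v)).
by split=> //; apply: recf_comp.
Qed.

Local Open Scope ring_scope.

Lemma recq_nat f : recf f -> recq (fun v => (f v)%:R).
Proof.
move=> rf; exists f, (fun=> 0%N), (fun=> 1%N).
by split=> [||||v] //; first [recur | rewrite subr0 divr1].
Qed.

Lemma recq_opp f : recq f -> recq (fun v => - f v).
Proof.
case=> p [q [d [rp rq rd d0 fE]]]; exists q, p, d; split=> // v.
by rewrite fE -mulNr opprB.
Qed.

Lemma recq_add f g : recq f -> recq g -> recq (fun v => f v + g v).
Proof.
case=> p [q [d [rp rq rd d0 fE]]] [p' [q' [d' [rp' rq' rd' d0' gE]]]].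
exists (fun v => p v * d' v + p' v * d v)%N,
       (fun v => q v * d' v + q' v * d v)%N, (fun v => d v * d' v)%N.
split=> [||||v]; try recur; first by move=> v; rewrite muln_gt0 d0 d0'.
rewrite fE gE !natrD !natrM; field.
by rewrite !pnatr_eq0 -!lt0n d0 d0'.
Qed.

Lemma recq_mul f g : recq f -> recq g -> recq (fun v => f v * g v).
Proof.
case=> p [q [d [rp rq rd d0 fE]]] [p' [q' [d' [rp' rq' rd' d0' gE]]]].
exists (fun v => p v * p' v + q v * q' v)%N,
       (fun v => p v * q' v + q v * p' v)%N, (fun v => d v * d' v)%N.
split=> [||||v]; try recur; first by move=> v; rewrite muln_gt0 d0 d0'.
rewrite fE gE !natrD !natrM; field.
by rewrite !pnatr_eq0 -!lt0n d0 d0'.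
Qed.

(** The form [.-1.+1] keeps the denominator positive everywhere and leaves positive values
    unchanged. *)
Lemma recq_div f d :
  recq f -> recf d -> recq (fun v => f v / (d v).-1.+1%:R).
Proof.
move=> rf rd; apply: recq_mul => //.
exists (fun=> 1%N), (fun=> 0%N), (fun v => (d v).-1.+1).
by split=> [||||v] //; first [recur | rewrite subr0 div1r].
Qed.

Lemma recq_if P f g :
  recb P -> recq f -> recq g -> recq (fun v => if P v then f v else g v).
Proof.
move=> rP [p [q [d [rp rq rd d0 fE]]]] [p' [q' [d' [rp' rq' rd' d0' gE]]]].
exists (fun v => if P v then p v else p' v),
  (fun v => if P v then q v else q' v),
  (fun v => if P v then d v else d' v).
by split=> [||||v]; try recur; [move=> v|]; case: (P v).
Qed.

Lemma recq_sum (F : nat -> seq nat -> rat) b :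
    recf b -> recq (fun w => F (head 0%N w) (behead w)) ->
  recq (fun v => \sum_(0 <= i < b v) F i v).
Proof.
move=> rb [p [q [d [rp rq rd d0 FE]]]].
have rat3 (e : seq nat -> nat) (he : recf e) : recf (fun w =>
    e (head 0%N w :: behead (behead w))).
  by apply: (recf_comp he); recur.
(* The common denominator is the product of all denominators; [c i] is the cofactor by which the
   numerator of term [i] is multiplied. *)
pose c i v := (\prod_(0 <= j < b v) (if j == i then 1 else d (j :: v)))%N.
have rc : recf (fun w => c (head 0%N w) (behead w)).
  apply: (@recf_prod (fun j w => if j == head 0 w then 1
                                 else d (j :: behead w))%N).
    by apply: (recf_comp rb); recur.
  apply: recf_if; [by recur|by recur|].
  by apply: (recf_comp rd); recur.
have rS (e : seq nat -> nat) (re : recf e) :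
    recf (fun v => \sum_(0 <= i < b v) e (i :: v) * c i v)%N.
  apply: recf_sum => //; apply: recf_mul => //.
  by apply: (recf_comp re); recur.
exists (fun v => \sum_(0 <= i < b v) p (i :: v) * c i v)%N,
       (fun v => \sum_(0 <= i < b v) q (i :: v) * c i v)%N,
       (fun v => \prod_(0 <= i < b v) d (i :: v))%N.
split=> [|||v|v]; [exact: rS|exact: rS| | |].
- by apply: recf_prod => //; apply: (recf_comp rd); recur.
- by apply: prodn_gt0.
rewrite !natr_sum -sumrB mulr_suml; apply: eq_big_seq => i i_in.
have /= -> := FE (i :: v).
have -> : (\prod_(0 <= j < b v) d (j :: v) = d (i :: v) * c i v)%N.
  rewrite /c [LHS](bigD1_seq i) ?iota_uniq //=; congr (_ * _)%N.
  rewrite [RHS](bigD1_seq i) ?iota_uniq //= eqxx mul1n.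
  by apply: eq_bigr => j /negPf ->.
have c0 : (c i v)%:R != 0 :> rat.
  by rewrite pnatr_eq0 -lt0n; apply: prodn_gt0 => j; case: eqP.
have di0 : (d (i :: v))%:R != 0 :> rat by rewrite pnatr_eq0 -lt0n.
by rewrite !natrM; field; rewrite c0 di0.
Qed.

Lemma recb_ge0 f : recq f -> recb (fun v => 0 <= f v).
Proof.
case=> p [q [d [rp rq rd d0 fE]]].
apply: recb_ext (recb_leq rq rp) _ => v.
by rewrite fE pmulr_lge0 ?invr_gt0 ?ltr0n // subr_ge0 ler_nat.
Qed.

Lemma recb_eq0 f : recq f -> recb (fun v => f v == 0).
Proof.
move=> rf; apply: recb_ext
  (recb_and (recb_ge0 rf) (recb_ge0 (recq_opp rf))) _ => v.
by rewrite oppr_ge0 andbC -eq_le.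
Qed.

Lemma recb_gt0 f : recq f -> recb (fun v => 0 < f v).
Proof.
move=> rf; apply: recb_ext (recb_not (recb_ge0 (recq_opp rf))) _ => v.
by rewrite oppr_ge0 ltNge.
Qed.

#[local] Hint Resolve recq_nat recq_opp recq_add recq_mul recq_div recq_if
  recq_sum recb_ge0 recb_eq0 recb_gt0 : rec.

(** An odd integer code [2k+1] stands for [-(k+1)], whence the successor; a denominator is positive,
    so its code is twice its value. Numbers that code no rational are also given a value. *)
Definition dec_rat (z : nat) : rat :=
  let p := cnth z 0 in
  (if odd p then - (p./2.+1)%:R else (p./2)%:R) / (cnth z 1)./2.-1.+1%:R.

Lemma rat_codeK : cancel rat_code dec_rat.
Proof.
move=> q; rewrite /dec_rat /rat_code /cnth CodeSeq.codeK /=.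
rewrite -[RHS]divq_num_den; congr (_ / _).
  by case: (numq q) => k /=;
     rewrite ?uphalf_double ?doubleK ?oddS odd_double.
have := denq_gt0 q; case: (denq q) => // -[|k] // _ /=.
by rewrite doubleK.
Qed.

Lemma recq_dec f : recf f -> recq (fun v => dec_rat (f v)).
Proof. by move=> rf; rewrite /dec_rat; recur. Qed.

#[local] Hint Resolve recq_dec : rec.

(** * Farkas' lemma *)

Definition dot d (u v : 'rV[rat]_d) : rat := (u *m v^T) 0 0.

Lemma dotDl d (u v w : 'rV[rat]_d) : dot (u + v) w = dot u w + dot v w.
Proof. by rewrite /dot mulmxDl mxE. Qed.

Lemma dotZl d a (u v : 'rV[rat]_d) : dot (a *: u) v = a * dot u v.
Proof. by rewrite /dot -scalemxAl mxE. Qed.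

Lemma dotC d (u v : 'rV[rat]_d) : dot u v = dot v u.
Proof.
by rewrite /dot -[RHS]trace_mx11 -mxtrace_tr trmx_mul trmxK trace_mx11.
Qed.

Lemma dotBl d (u v w : 'rV[rat]_d) : dot (u - v) w = dot u w - dot v w.
Proof. by rewrite dotDl -scaleN1r dotZl mulN1r. Qed.

Lemma dotBr d (u v w : 'rV[rat]_d) : dot u (v - w) = dot u v - dot u w.
Proof. by rewrite !(dotC u) dotBl. Qed.

Lemma dotZr d a (u v : 'rV[rat]_d) : dot u (a *: v) = a * dot u v.
Proof. by rewrite !(dotC u) dotZl. Qed.

Lemma dot_gt0 d (u : 'rV[rat]_d) : u != 0 -> 0 < dot u u.
Proof.
have dotE : dot u u = \sum_j u 0 j ^+ 2.
  by rewrite /dot mxE; apply: eq_bigr => j _; rewrite mxE.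
have ge0 : 0 <= dot u u by rewrite dotE sumr_ge0 // => j _; apply: sqr_ge0.
move=> u_neq0; rewrite lt_neqAle ge0 andbT eq_sym.
apply: contra u_neq0; rewrite dotE psumr_eq0 => [/allP u0|j _]; last first.
  exact: sqr_ge0.
apply/eqP/rowP => j; rewrite mxE; apply/eqP.
by rewrite -sqrf_eq0; apply: u0; rewrite mem_index_enum.
Qed.

(** The convex cone spanned by [us], in a form suited to induction on the list. *)
Fixpoint incone d (us : seq 'rV[rat]_d) (b : 'rV[rat]_d) : Prop :=
  if us is u :: us' then exists2 t : rat, 0 <= t & incone us' (b - t *: u)
  else b = 0.

(** By the signs of the products with [y], each projected vector is [u] plus a nonnegative multiple
    of [v]; these multiples are collected in [t]. *)
Lemma incone_project d (us : seq 'rV[rat]_d) (v y b : 'rV[rat]_d) :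
    dot v y < 0 -> all (fun u => 0 <= dot u y) us ->
    incone [seq u - (dot u y / dot v y) *: v | u <- us] b ->
  exists2 t, 0 <= t & incone us (b - t *: v).
Proof.
move=> vy0; elim: us b => [|u us IHus] b /=.
  by move=> _ ->; exists 0; rewrite // scale0r subrr.
case/andP=> uy0 usy0 [s s0 /(IHus _ usy0)[t t0 bin]].
exists (t - s * (dot u y / dot v y)).
  rewrite subr_ge0 (le_trans _ t0) // mulr_ge0_le0 // mulr_ge0_le0 //.
  by rewrite invr_le0 ltW.
exists s => //; suff -> : b - (t - s * (dot u y / dot v y)) *: v - s *: u =
    b - s *: (u - (dot u y / dot v y) *: v) - t *: v by [].
by apply/rowP => j; rewrite !mxE; ring.
Qed.

(* The vectors are projected along [v] onto the hyperplane orthogonal to [y]. *)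
Lemma farkas_cone d (us : seq 'rV[rat]_d) (b : 'rV[rat]_d) :
  incone us b \/
  exists2 y, all (fun u => 0 <= dot u y) us & dot b y < 0.
Proof.
have [n] := ubnP (size us); elim: n us b => // n IHn [|v us] b /=.
  move=> _; have [->|b0] := eqVneq b 0; [by left | right].
  by exists ((-1) *: b) => //; rewrite dotZr mulN1r oppr_lt0 dot_gt0.
rewrite ltnS => sz_us; have [bin|[y usy by0]] := IHn us b sz_us.
  by left; exists 0; rewrite // scale0r subr0.
have [vy0|vy0] := leP 0 (dot v y); first by right; exists y => //=; apply/andP.
pose pr u := u - (dot u y / dot v y) *: v.
have vy_neq0 : dot v y != 0 by rewrite lt_eqF.
have [|bin|[z usz bz0]] := IHn (map pr us) (pr b); first by rewrite size_map.
  left; have [t t0 {}bin] := incone_project vy0 usy bin.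
  exists (dot b y / dot v y + t); last by rewrite scalerDl opprD addrA.
  by rewrite addr_ge0 // mulr_le0 ?invr_le0 // ltW.
(* This is the image of [z] under the adjoint of [pr]: its product with any [u] is that of [pr u]
   with [z], and it is orthogonal to [v]. *)
right; exists (z - (dot v z / dot v y) *: y).
  apply/andP; split; first by rewrite dotBr dotZr divfK // subrr.
  move: usz; rewrite all_map; apply: sub_all => u /=.
  by rewrite dotBl dotZl dotBr dotZr; apply: etrans; congr (_ <= _); ring.
move: bz0; rewrite dotBl dotZl dotBr dotZr.
by apply: etrans; congr (_ < _); ring.
Qed.

(** Denominators are cleared because the coefficients will serve as multiplicities of letters in a
    word. *)
Lemma incone_nat d (us : seq 'rV[rat]_d) (b : 'rV[rat]_d) : incone us b ->
  exists (N : nat) (x : nat -> nat), (0 < N)%N /\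
    N%:R *: b = \sum_(0 <= s < size us) (x s)%:R *: nth 0 us s.
Proof.
elim: us b => [|u us IHus] b /=.
  by move=> ->; exists 1%N, id; rewrite big_geq // scaler0.
case=> t t0 /IHus[N [x [N0 Nb]]].
have tE : t * `|denq t|%:R = `|numq t|%:R.
  by rewrite !natr_absz gtr0_norm ?denq_gt0 // ger0_norm ?numq_ge0 // -numqE.
exists (N * `|denq t|)%N,
  (fun s => if s is s'.+1 then `|denq t| * x s' else N * `|numq t|)%N.
split; first by rewrite muln_gt0 N0 absz_gt0 denq_neq0.
rewrite big_nat_recl //=; under [X in _ + X]eq_bigr do rewrite natrM -scalerA.
rewrite -scaler_sumr -Nb !natrM -tE.
by apply/rowP => j; rewrite !mxE; ring.
Qed.

(** If minus row [i] lies in the cone of the rows, moving it to the other side gives a nonnegative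
    relation in which row [i] occurs. Otherwise a vector separating it from the cone has positive
    product with row [i]. *)
Lemma farkas k d (M : nat -> nat -> rat) i : (i < k)%N ->
  (exists2 x : nat -> nat, (0 < x i)%N & forall j, (j < d)%N ->
     \sum_(0 <= s < k) (x s)%:R * M s j = 0) \/
  (exists2 y : nat -> rat, 0 < \sum_(0 <= j < d) M i j * y j &
     forall s, (s < k)%N -> 0 <= \sum_(0 <= j < d) M s j * y j).
Proof.
move=> lt_ik; pose r s : 'rV[rat]_d := \row_j M s j.
have dotE s (y : 'rV[rat]_d) (y' : nat -> rat) :
    (forall j : 'I_d, y' j = y 0 j) ->
    dot (r s) y = \sum_(0 <= j < d) M s j * y' j.
  move=> y'E; rewrite big_mkord /dot mxE.
  by apply: eq_bigr => j _; rewrite !mxE y'E.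
have [/incone_nat[N [x [N0 Nb]]]|[y us_y b_y]] :=
  farkas_cone (mkseq r k) (- r i); [left | right].
  exists (fun s => x s + N * (s == i))%N.
    by rewrite eqxx addn_gt0 muln1 N0 orbT.
  move=> j lt_jd; have /rowP/(_ (Ordinal lt_jd)) := Nb.
  rewrite !mxE summxE size_mkseq => xE.
  under eq_bigr do rewrite natrD mulrDl.
  rewrite big_split /= [X in _ + X](bigD1_seq i) ?iota_uniq ?mem_index_iota //=.
  rewrite eqxx muln1 [X in _ + (_ + X)]big1 => [|s s_neq_i]; last first.
    by rewrite (negPf s_neq_i) muln0 mul0r.
  rewrite addr0; have -> : \sum_(0 <= s < k) (x s)%:R * M s j = N%:R * - M i j.
    rewrite xE; apply: eq_big_nat => s lt_s; rewrite nth_mkseq // !mxE //.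
  by ring.
pose y' j := if insub j is Some j' then y 0 j' else 0.
have y'E (j : 'I_d) : y' j = y 0 j by rewrite /y' valK.
exists y' => [|s lt_s]; rewrite -(dotE _ y) //.
  by move: b_y; rewrite -scaleN1r dotZl mulN1r oppr_lt0.
by have /allP := us_y; apply; apply/mapP; exists s; rewrite ?mem_iota.
Qed.

(** Pairing [x M = 0] with [y] gives a vanishing sum of nonnegative terms, whose term [i] would be
    positive. *)
Lemma farkas_exclusive k d (M : nat -> nat -> rat) i (x : nat -> nat)
    (y : nat -> rat) :
    (i < k)%N -> (0 < x i)%N ->
    (forall j, (j < d)%N -> \sum_(0 <= s < k) (x s)%:R * M s j = 0) ->
    (forall s, (s < k)%N -> 0 <= \sum_(0 <= j < d) M s j * y j) ->
  ~ 0 < \sum_(0 <= j < d) M i j * y j.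
Proof.
move=> lt_ik xi0 xM My Miy.
have : \sum_(0 <= s < k) (x s)%:R * (\sum_(0 <= j < d) M s j * y j) = 0.
  under eq_bigr do rewrite mulr_sumr.
  rewrite exchange_big /= big1_seq // => j /=; rewrite mem_index_iota => lt_j.
  under eq_bigr do rewrite mulrA.
  by rewrite -mulr_suml xM ?mul0r.
rewrite (bigD1_seq i) ?iota_uniq ?mem_index_iota //=.
apply/eqP; rewrite gt_eqF // ltr_wpDr ?mulr_gt0 ?ltr0n //.
rewrite big_nat_cond sumr_ge0 // => s /andP[lt_s _].
by rewrite mulr_ge0 ?ler0n ?My.
Qed.

(** * Deciding the supports of solutions *)

Definition supported k d (M : nat -> nat -> rat) i : Prop :=
  exists2 x : nat -> nat, (0 < x i)%N & forall j, (j < d)%N ->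
    \sum_(0 <= s < k) (x s)%:R * M s j = 0.

(** The search looks for a number [w] coding a solution ([X]) or a Farkas certificate ([Y]), and the
    kind of certificate found is the answer. The matrix depends on the instance code [c], so a
    single algorithm serves all instances. *)
Lemma supported_decidable d (M : nat -> nat -> nat -> rat) :
    (forall f g h, recf f -> recf g -> recf h ->
       recq (fun v => M (f v) (g v) (h v))) ->
  exists2 D : nat -> nat -> bool,
    forall f g, recf f -> recf g -> recb (fun v => D (f v) (g v)) &
    forall c i, (i < csize c)%N -> D c i <-> supported (csize c) d (M c) i.
Proof.
move=> rM.
pose X w c i := (0 < cnth w i)%N &&
  all (fun j => \sum_(0 <= s < csize c) (cnth w s)%:R * M c s j == 0)
    (iota 0 d).
pose Y w c i := (0 < \sum_(0 <= j < d) M c i j * dec_rat (cnth w j)) &&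
  all (fun s => 0 <= \sum_(0 <= j < d) M c s j * dec_rat (cnth w j))
    (iota 0 (csize c)).
have rX f g h : recf f -> recf g -> recf h ->
    recb (fun v => X (f v) (g v) (h v)).
  have rX0 : recb (fun v => X (nth 0 v 0) (nth 0 v 1) (nth 0 v 2))%N.
    by rewrite /X; recur.
  move=> rf rg rh.
  exact: (recb_comp rX0 (recs_cons rf (recs_cons rg (recs_cons rh recs_nil)))).
have rY f g h : recf f -> recf g -> recf h ->
    recb (fun v => Y (f v) (g v) (h v)).
  have rY0 : recb (fun v => Y (nth 0 v 0) (nth 0 v 1) (nth 0 v 2))%N.
    by rewrite /Y; recur.
  move=> rf rg rh.
  exact: (recb_comp rY0 (recs_cons rf (recs_cons rg (recs_cons rh recs_nil)))).
have codeX (x : nat -> nat) k i : (i < k)%N ->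
    cnth (CodeSeq.code (mkseq x k)) i = x i.
  by move=> lt_i; rewrite /cnth CodeSeq.codeK nth_mkseq.
have total v : exists w, X w (head 0%N v) (head 0%N (behead v)) ||
                         Y w (head 0%N v) (head 0%N (behead v)).
  set c := head _ v; set i := head _ _.
  have [lt_i|le_i] := ltnP i (csize c); last first.
    (* The search has to stop for out of range indices as well: the entry of  *)
    (* index i of x does not occur in the equations.                          *)
    exists (CodeSeq.code (mkseq (fun s => nat_of_bool (s == i)) i.+1)).
    apply/orP; left; rewrite /X codeX // eqxx.
    apply/andP; split=> //; apply/allP => j _.
    rewrite big1_seq // => s; rewrite mem_index_iota => /andP[_ lt_s].
    by rewrite codeX ?ltn_eqF ?mul0r //; lia.
  have [[x xi0 xM]|[y yi0 yM]] := farkas d (M c) lt_i.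
    exists (CodeSeq.code (mkseq x (csize c))).
    apply/orP; left; rewrite /X codeX // xi0; apply/allP => j.
    rewrite mem_iota => lt_j; apply/eqP; rewrite -[RHS](xM j) //.
    by apply: eq_big_nat => s lt_s; rewrite codeX.
  pose w := CodeSeq.code (mkseq (fun j => rat_code (y j)) d).
  exists w; apply/orP; right.
  have MyE s : \sum_(0 <= j < d) M c s j * dec_rat (cnth w j) =
               \sum_(0 <= j < d) M c s j * y j.
    by apply: eq_big_nat => j lt_j; rewrite codeX // rat_codeK.
  by rewrite /Y MyE yi0; apply/allP => s; rewrite mem_iota MyE => /yM.
have [|g [rg gP]] := recf_search (P := fun w v =>
    X w (head 0%N v) (head 0%N (behead v)) ||
    Y w (head 0%N v) (head 0%N (behead v))) total.
  by apply: recb_or; [apply: rX | apply: rY]; recur.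
exists (fun c i => X (g [:: c; i]) c i) => [f h rf rh | c i lt_i].
  by apply: rX => //; apply: (recf_comp rg); recur.
split=> [/andP[x0 /allP xM]|[x xi0 xM]].
  exists (cnth (g [:: c; i])) => // j lt_j.
  by apply/eqP/xM; rewrite mem_iota.
have /orP[//|/andP[y0 /allP yM]] := gP [:: c; i].
case: (farkas_exclusive lt_i xi0 xM _ y0) => s lt_s.
by apply: yM; rewrite mem_iota.
Qed.

(** * Words in the Heisenberg group *)

Section HeisenbergWords.

Variables (V : zmodType) (B : V -> V -> rat).
Hypothesis BDl : forall u v w, B (u + v) w = B u w + B v w.
Hypothesis BDr : forall u v w, B u (v + w) = B u v + B u w.

Implicit Types (g h : V * rat) (w : seq (V * rat)).

Definition hmul g h : V * rat := (g.1 + h.1, g.2 + h.2 + B g.1 h.1).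

Definition hprod w : V * rat := foldr hmul (0, 0) w.

Definition hcomm u v : rat := B u v - B v u.

(* The central entry of the matrix logarithm, when B is the dot product.      *)
Definition hlog g : rat := g.2 - B g.1 g.1 / 2%:R.

Let B0l v : B 0 v = 0.
Proof. by apply: (addrI (B 0 v)); rewrite -BDl !addr0. Qed.

Let B0r v : B v 0 = 0.
Proof. by apply: (addrI (B v 0)); rewrite -BDr !addr0. Qed.

Let hcommDl u v x : hcomm (u + v) x = hcomm u x + hcomm v x.
Proof. by rewrite /hcomm BDl BDr opprD addrACA. Qed.

Let hcommC u v : hcomm u v = - hcomm v u.
Proof. by rewrite /hcomm opprB. Qed.

Let hcomm0l u : hcomm 0 u = 0.
Proof. by rewrite /hcomm B0l B0r subrr. Qed.

Let hcommMn u v k : hcomm (u *+ k) v = hcomm u v *+ k.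
Proof. by elim: k => [|k IHk]; rewrite ?hcomm0l // !mulrS hcommDl IHk. Qed.

Let hcommvv u : hcomm u u = 0.
Proof. exact: subrr. Qed.

(** The Baker-Campbell-Hausdorff formula, which stops after the first bracket because the group is
    nilpotent of class two. *)
Let hlog_mul g h : hlog (hmul g h) = hlog g + hlog h + hcomm g.1 h.1 / 2%:R.
Proof. by rewrite /hlog /hcomm /= !BDl !BDr; field. Qed.

Let hlog0 : hlog (0, 0) = 0.
Proof. by rewrite /hlog B0l mul0r subr0. Qed.

Let hlog_eq0 g : g.1 = 0 -> hlog g = 0 -> g = (0, 0).
Proof. by case: g => u c /= ->; rewrite /hlog B0l mul0r subr0 /= => ->. Qed.

Let hprod_cat w w' : hprod (w ++ w') = hmul (hprod w) (hprod w').
Proof.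
elim: w => [|g w IHw] /=.
  by rewrite /hmul B0l !add0r addr0; case: (hprod w').
by rewrite IHw /hmul /= BDl BDr !addrA; congr (_, _); ring.
Qed.

Let hprod1 w : (hprod w).1 = \sum_(g <- w) g.1.
Proof. by elim: w => [|g w IHw]; rewrite ?big_nil // big_cons -IHw. Qed.

Let hcomm_suml w u : hcomm (\sum_(g <- w) g.1) u = \sum_(g <- w) hcomm g.1 u.
Proof.
by apply: (big_morph (hcomm^~ u)) => [v v'|]; rewrite ?hcommDl ?hcomm0l.
Qed.

Let hlog_commuting w :
    {in w &, forall g h, hcomm g.1 h.1 = 0} ->
  hlog (hprod w) = \sum_(g <- w) hlog g.
Proof.
elim: w => [|g w IHw] comm_w /=; first by rewrite big_nil hlog0.
rewrite big_cons hlog_mul IHw => [|h h' w_h w_h']; last first.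
  by apply: comm_w; rewrite inE (w_h, w_h') orbT.
rewrite hprod1 hcommC hcomm_suml [X in - X]big1_seq ?oppr0 ?mul0r ?addr0 //.
by move=> h /= w_h; apply: comm_w; rewrite inE ?eqxx ?w_h ?orbT.
Qed.

Let wpow k w := flatten (nseq k w).

Let hprod_wpow k w :
  (hprod (wpow k w)).1 = (hprod w).1 *+ k /\
  hlog (hprod (wpow k w)) = hlog (hprod w) *+ k.
Proof.
elim: k => [|k [IH1 IH2]] //=.
rewrite hprod_cat hlog_mul IH2 /= IH1 !mulrS; split=> //.
by rewrite hcommC hcommMn hcommvv mul0rn oppr0 mul0r addr0.
Qed.

Let mem_wpow k w g : g \in wpow k w -> g \in w.
Proof. by elim: k => //= k IHk; rewrite mem_cat => /orP[|/IHk]. Qed.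

Let balance (c d : rat) : 0 < c -> d < 0 ->
  exists k l : nat, (0 < k)%N /\ c *+ k + d *+ l = 0.
Proof.
move=> c0 d0.
exists (`|numq d| * `|denq c|)%N, (`|numq c| * `|denq d|)%N.
have d_neq0 : numq d != 0 by rewrite numq_eq0 lt_eqF.
split; first by rewrite muln_gt0 !absz_gt0 d_neq0 denq_neq0.
rewrite -(mulr_natr c) -(mulr_natr d) !natrM !natr_absz.
rewrite !(gtr0_norm (denq_gt0 _)).
rewrite (gtr0_norm (_ : 0 < numq c)) ?numq_gt0 //.
rewrite (ltr0_norm (_ : numq d < 0)) ?numq_lt0 //.
by rewrite rmorphN /= (numqE c) (numqE d); ring.
Qed.

Let block k g h w := wpow k [:: g] ++ wpow k [:: h] ++ wpow k w.

(** The powers of [h] and [w] together have first component opposite to that of the power of [g], so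
    their bracket with it vanishes. Only the bracket between the powers of [h] and [w] survives, and
    it gives the quadratic term. *)
Let hprod_block k g h w : g.1 + h.1 + (hprod w).1 = 0 ->
  (hprod (block k g h w)).1 = 0 /\
  hlog (hprod (block k g h w)) =
    k%:R * (hlog g + hlog h + hlog (hprod w) + k%:R * (hcomm g.1 h.1 / 2%:R)).
Proof.
move=> ghw0; have [g1 gl] := hprod_wpow k [:: g].
have [h1 hl] := hprod_wpow k [:: h]; have [w1 wl] := hprod_wpow k w.
have single f : hmul f (0, 0) = f.
  by case: f => u c; rewrite /hmul B0r !addr0.
rewrite /= addr0 in g1; rewrite /= addr0 in h1.
rewrite /= single in gl; rewrite /= single in hl.
have wE : (hprod w).1 = - g.1 - h.1.
  by apply/eqP; rewrite -opprD -addr_eq0 addrC; apply/eqP.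
rewrite /block !hprod_cat; split.
  rewrite /= g1 h1 w1 -!mulrnDl. by rewrite addrA ghw0 mul0rn.
rewrite !hlog_mul gl hl wl /= g1 h1 w1.
have hcommNl u v : hcomm (- u) v = - hcomm u v.
  by apply/eqP; rewrite -addr_eq0 -hcommDl addNr hcomm0l.
have -> : h.1 *+ k + (hprod w).1 *+ k = - g.1 *+ k.
  by rewrite -mulrnDl wE addrC addrNK.
rewrite !hcommMn (hcommC g.1) hcommMn hcommNl hcommvv oppr0 mul0rn oppr0 mul0rn.
rewrite (hcommC h.1) hcommMn wE hcommDl !hcommNl hcommvv subr0.
rewrite !subr0 !mulNrn opprK -mulrnA -!(mulr_natr (hlog _)).
by rewrite -(mulr_natr (hcomm _ _)) natrM; field.
Qed.

(* Moving a block of [g]'s across a block of [h]'s changes the central entry  *)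
(* quadratically in the length of the blocks, whereas the rest contributes    *)
(* linearly: both signs occur.                                                *)
Let twist w g h : hcomm g.1 h.1 != 0 -> g.1 + h.1 + (hprod w).1 = 0 ->
  exists2 w', w' != [::] & {subset w' <= g :: h :: w} /\ hprod w' = (0, 0).
Proof.
move=> gh_neq0 gh0; wlog gh_gt0 : g h gh_neq0 gh0 / 0 < hcomm g.1 h.1.
  move=> IH; have [|] := ltrP 0 (hcomm g.1 h.1); first exact: IH.
  rewrite le_eqVlt (negPf gh_neq0) /= hcommC oppr_lt0 => hg_gt0.
  have [||//|w' w'0 [sub_w' w'1]] := IH h g.
  - by rewrite hcommC oppr_eq0.
  - by rewrite (addrC h.1).
  by exists w' => //; split=> // f /sub_w'; rewrite !inE orbCA.
have gh0' : h.1 + g.1 + (hprod w).1 = 0 by rewrite (addrC h.1).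
pose L := hlog g + hlog h + hlog (hprod w); pose om := hcomm g.1 h.1 / 2%:R.
have om_gt0 : 0 < om by rewrite divr_gt0.
(* For such [k] the logs [k(L + k om)] and [k(L - k om)] of the blocks starting with [g] and with
   [h] have opposite signs. Both blocks are central, so suitable powers cancel. *)
have [k k_gt0N ltL] : exists2 k, (0 < k)%N & `|L| < k%:R * om.
  exists (Num.bound (`|L| / om)).+1 => //.
  rewrite -ltr_pdivrMr //; apply: lt_le_trans (archi_boundP _) _.
    by rewrite divr_ge0 // ltW.
  by rewrite ler_nat.
have k_gt0 : 0 < k%:R :> rat by rewrite ltr0n.
have [p1 pl] := hprod_block k gh0; have [n1 nl] := hprod_block k gh0'.
move: ltL; rewrite ltr_norml => /andP[ltL gtL].
have [||a [b [a_gt0 ab0]]] :=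
    @balance (hlog (hprod (block k g h w))) (hlog (hprod (block k h g w))).
- by rewrite pl mulr_gt0 // -ltrBlDr sub0r.
- rewrite nl pmulr_rlt0 // (addrC (hlog h)) (hcommC h.1) mulNr mulrN.
  by rewrite subr_lt0.
have sub_block f f' : {subset block k f f' w <= f :: f' :: w}.
  move=> e.
  by rewrite !mem_cat => /or3P[] /mem_wpow; rewrite !inE => ->; rewrite ?orbT.
exists (wpow a (block k g h w) ++ wpow b (block k h g w)).
  rewrite -size_eq0 !size_cat addn_eq0 negb_and -!lt0n; apply/orP; left.
  case: a a_gt0 ab0 => // a _ _; rewrite !size_cat /=.
  by rewrite -(prednK k_gt0N).
split=> [e|].
  rewrite mem_cat => /orP[] /mem_wpow/sub_block //.
  by rewrite !inE orbCA.
have [P1 Pl] := hprod_wpow a (block k g h w).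
have [N1 Nl] := hprod_wpow b (block k h g w).
rewrite hprod_cat; apply: hlog_eq0.
  by rewrite /= P1 N1 p1 n1 !mul0rn addr0.
by rewrite hlog_mul Pl Nl P1 p1 mul0rn hcomm0l mul0r addr0.
Qed.

(** The concatenation has total zero; what is left after taking out one [g] and one [h] plays the
    role of [w] in [twist]. *)
Let twist_words w w' g h :
    g \in w -> h \in w' -> hcomm g.1 h.1 != 0 ->
    \sum_(f <- w) f.1 = 0 -> \sum_(f <- w') f.1 = 0 ->
  exists2 w'', w'' != [::] & {subset w'' <= w ++ w'} /\ hprod w'' = (0, 0).
Proof.
move=> w_g w'_h gh_neq0 w0 w'0.
have [|w'' w''_n0 [sub1 eq1]] := @twist (rem g w ++ rem h w') g h gh_neq0.
  move: w0 w'0; rewrite (perm_big _ (perm_to_rem w_g)) big_cons => w0.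
  rewrite (perm_big _ (perm_to_rem w'_h)) big_cons => w'0.
  by rewrite hprod1 big_cat addrACA /= w0 w'0 addr0.
exists w'' => //; split=> // f /sub1; rewrite !inE !mem_cat.
case/or4P=> [/eqP->|/eqP->|/mem_rem->|/mem_rem->]; rewrite ?w_g ?w'_h ?orbT //.
Qed.

(** * Words and multiplicity vectors *)

(** A letter is counted at its first position in [G], so that repeated generators are not counted
    twice. *)
Definition counts (G w : seq (V * rat)) (s : nat) : nat :=
  count (fun g => index g G == s) w.

Let sum_counts (G w : seq (V * rat)) (Z : zmodType) (F : V * rat -> Z) :
    {subset w <= G} ->
  \sum_(g <- w) F g =
    \sum_(0 <= s < size G) F (nth (0, 0) G s) *+ counts G w s.
Proof.
elim: w => [|g w IHw] sub_w.
  by rewrite big_nil big1 // => s _; rewrite mulr0n.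
have G_g : g \in G by apply: sub_w; rewrite inE eqxx.
rewrite big_cons IHw => [|f w_f]; last by apply: sub_w; rewrite inE w_f orbT.
under [RHS]eq_bigr do rewrite /counts /= mulrnDr.
rewrite big_split /=; congr (_ + _).
rewrite (bigD1_seq (index g G)) ?iota_uniq ?mem_index_iota ?index_mem //=.
rewrite eqxx mulr1n nth_index // big1 ?addr0 // => s s_neq.
by rewrite eq_sym (negPf s_neq) mulr0n.
Qed.

Let counts_gt0 G w g : g \in w -> (0 < counts G w (index g G))%N.
Proof. by move=> w_g; rewrite -has_count; apply/hasP; exists g. Qed.

Definition wordof (G : seq (V * rat)) (x : nat -> nat) : seq (V * rat) :=
  flatten [seq nseq (x s) (nth (0, 0) G s) | s <- index_iota 0 (size G)].

Let sum_wordof G x (Z : zmodType) (F : V * rat -> Z) :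
  \sum_(g <- wordof G x) F g =
    \sum_(0 <= s < size G) F (nth (0, 0) G s) *+ x s.
Proof.
rewrite big_flatten big_map; apply: eq_bigr => s _.
by rewrite big_nseq; elim: (x s) => //= k ->; rewrite mulrS.
Qed.

Let mem_wordof G x i : (i < size G)%N -> (0 < x i)%N ->
  nth (0, 0) G i \in wordof G x.
Proof.
move=> lt_i xi; apply/flatten_mapP; exists i; first by rewrite mem_index_iota.
by rewrite mem_nseq xi eqxx.
Qed.

Let sub_wordof G x g : g \in wordof G x -> g \in G.
Proof.
move=> /flatten_mapP[s]; rewrite mem_index_iota => lt_s.
by rewrite mem_nseq => /andP[_ /eqP->]; apply: mem_nth.
Qed.

(** A word for the identity gives the first alternative if its letters commute, since logs then add
    up, and the second otherwise. Conversely, solutions are spelled out as words, to which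
    additivity of the log or [twist_words] applies. *)
Lemma identity_wordP (G : seq (V * rat)) :
  (exists2 w, w != [::] & {subset w <= G} /\ hprod w = (0, 0)) <->
  (exists i, (i < size G)%N /\ exists2 x : nat -> nat, (0 < x i)%N &
     \sum_(0 <= s < size G) (nth (0, 0) G s).1 *+ x s = 0 /\
     \sum_(0 <= s < size G) hlog (nth (0, 0) G s) *+ x s = 0) \/
  (exists i j, [/\ (i < size G)%N, (j < size G)%N,
     hcomm (nth (0, 0) G i).1 (nth (0, 0) G j).1 != 0,
     (exists2 x : nat -> nat, (0 < x i)%N &
        \sum_(0 <= s < size G) (nth (0, 0) G s).1 *+ x s = 0) &
     (exists2 x : nat -> nat, (0 < x j)%N &
        \sum_(0 <= s < size G) (nth (0, 0) G s).1 *+ x s = 0)]).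
Proof.
split=> [[w w0 [wG w1]]|].
  have sw0 : \sum_(s <- w) s.1 = 0 by rewrite -hprod1 w1.
  case: (boolP (all (fun g => all (fun h => hcomm g.1 h.1 == 0) w) w)).
    move=> /allP comm_w; left; case: w w0 => // g w _ in wG w1 sw0 comm_w *.
    have wg : g \in g :: w by rewrite inE eqxx.
    exists (index g G); split; first by rewrite index_mem wG.
    exists (counts G (g :: w)); first exact: counts_gt0.
    rewrite -!(sum_counts _ wG) sw0 -hlog_commuting ?w1 // => f h /comm_w/allP.
    by move=> /[apply]/eqP.
  case/allPn => g wg /allPn[h wh gh]; right.
  exists (index g G), (index h G); rewrite !index_mem !nth_index ?wG //.
  by split=> //; exists (counts G w); rewrite -?(sum_counts _ wG) ?counts_gt0.
case=> [[i [lt_i [x xi [xu xl]]]]|[i [j [lt_i lt_j gh [x xi xu] [y yj yu]]]]].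
  rewrite -sum_wordof in xu; rewrite -sum_wordof in xl.
  set w := wordof G x in xu xl.
  case: (boolP (all (fun g => all (fun h => hcomm g.1 h.1 == 0) w) w)).
    move=> /allP comm_w; exists w.
      by have := mem_wordof lt_i xi; rewrite -/w; case: (w).
    split; first exact: sub_wordof.
    apply: hlog_eq0; first by rewrite hprod1.
    by rewrite hlog_commuting // => f h /comm_w/allP/[apply]/eqP.
  (* When letters of [w] do not commute, the product of [w] may differ from the identity, and two
     copies of [w] are twisted instead. *)
  case/allPn => g wg /allPn[h wh gh].
  have [w' w'0 [sub_w' w'1]] := twist_words wg wh gh xu xu.
  exists w' => //; split=> // f /sub_w'.
  by rewrite mem_cat => /orP[] /sub_wordof.
rewrite -sum_wordof in xu; rewrite -sum_wordof in yu.
have [w w0 [sub_w w1]] :=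
  twist_words (mem_wordof lt_i xi) (mem_wordof lt_j yj) gh xu yu.
exists w => //; split=> // f /sub_w.
by rewrite mem_cat => /orP[] /sub_wordof.
Qed.

End HeisenbergWords.

(** * The identity problem *)

Lemma recq_const (a : rat) : recq (fun=> a).
Proof.
apply: recq_ext (recq_dec (recf_const (rat_code a))) _ => v.
by rewrite rat_codeK.
Qed.
#[local] Hint Resolve recq_const : rec.

Lemma nth_allpairs (S T R : Type) (f : S -> T -> R) s t x0 y0 z0 i j :
    (i < size s)%N -> (j < size t)%N ->
  nth z0 [seq f x y | x <- s, y <- t] (i * size t + j) =
    f (nth x0 s i) (nth y0 t j).
Proof.
elim: s i => //= x s IHs [|i] lt_i lt_j; rewrite nth_cat size_map.
  by rewrite lt_j (nth_map y0).
by rewrite ltnNge mulSn -addnA leq_addr /= addKn IHs.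
Qed.

Lemma cnth_mx_code n (A : 'M[rat]_n) (i j : 'I_n) :
  cnth (mx_code A) (i * n + j) = rat_code (A i j).
Proof.
rewrite /cnth CodeSeq.codeK.
have := @nth_allpairs _ _ _ (fun i j => rat_code (A i j))
  (enum 'I_n) (enum 'I_n) i j 0%N i j.
by rewrite size_enum_ord !nth_ord_enum; apply.
Qed.

(** * From matrices to pairs *)

Section Heisenberg.

Variable m : nat.
Local Notation n := (1 + (m + 1))%N.
Local Notation V := ('cV[rat]_m * 'cV[rat]_m)%type.

Definition cdot (u v : V) : rat := (u.1^T *m v.2) 0 0.

Lemma cdotDl u v w : cdot (u + v) w = cdot u w + cdot v w.
Proof. by rewrite /cdot linearD mulmxDl mxE. Qed.

Lemma cdotDr u v w : cdot u (v + w) = cdot u v + cdot u w.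
Proof. by rewrite /cdot mulmxDr mxE. Qed.

Lemma cdotE u v : cdot u v = \sum_r u.1 r 0 * v.2 r 0.
Proof. by rewrite /cdot mxE; apply: eq_bigr => r _; rewrite mxE. Qed.

Definition hmx (g : V * rat) : 'M[rat]_n :=
  block_mx 1%:M (row_mx g.1.1^T g.2%:M) 0 (block_mx 1%:M g.1.2 0 1%:M).

Lemma hmxM g h : hmx g *m hmx h = hmx (hmul cdot g h).
Proof.
rewrite /hmx mulmx_block !mulmx0 !mul0mx !mul1mx !addr0 add0r.
rewrite mul_row_block !mulmx0 !mulmx1 addr0 add_row_mx mulmx_block.
rewrite !mulmx0 !mul0mx !mul1mx !mulmx1 !addr0 !add0r.
have -> : h.1.1^T + g.1.1^T = (g.1.1 + h.1.1)^T by rewrite linearD addrC.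
have -> : h.2%:M + (g.1.1^T *m h.1.2 + g.2%:M) = (g.2 + h.2 + cdot g.1 h.1)%:M.
  rewrite [_ *m _]mx11_scalar -!raddfD /cdot; congr _%:M; ring.
by rewrite (addrC h.1.2).
Qed.

Lemma hmx0 : hmx (0, 0) = 1%:M.
Proof.
by rewrite /hmx /= trmx0 raddf0 row_mx0 -!scalar_mx_block.
Qed.

Definition idx_first : 'I_n := lshift _ 0.
Definition idx_mid (r : 'I_m) : 'I_n := rshift 1 (lshift 1 r).
Definition idx_last : 'I_n := rshift 1 (rshift m 0).

Definition hcoef (A : 'M[rat]_n) : V * rat :=
  ((\col_r A idx_first (idx_mid r), \col_r A (idx_mid r) idx_last),
   A idx_first idx_last).

Lemma hmxK : cancel hmx hcoef.
Proof.
case=> [[a b] c]; rewrite /hcoef /hmx; congr (_, _, _) => /=.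
- by apply/colP => r; rewrite mxE block_mxEur row_mxEl mxE.
- by apply/colP => r; rewrite mxE block_mxEdr block_mxEur.
- by rewrite block_mxEur row_mxEr mxE.
Qed.

Lemma hmx_prod (s : seq 'M[rat]_n) :
  {in s, forall A, exists g, A = hmx g} ->
  \big[mulmx/1%:M]_(A <- s) A = hmx (hprod cdot (map hcoef s)).
Proof.
elim: s => [|A s IHs] hs; first by rewrite big_nil hmx0.
rewrite big_cons IHs => [|A' s_A']; last by apply: hs; rewrite inE s_A' orbT.
have [|g ->] := hs A; first by rewrite inE eqxx.
by rewrite hmxM /= hmxK.
Qed.

Lemma in_semigroup1P (G : seq 'M[rat]_n) :
  {in G, forall A, exists g, A = hmx g} ->
  in_semigroup G 1%:M <->
  exists2 w, w != [::] & {subset w <= map hcoef G} /\ hprod cdot w = (0, 0).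
Proof.
move=> hG; split=> [[s [s0 sG s1]]|[w w0 [wG w1]]].
  exists (map hcoef s); first by case: (s) s0.
  split=> [g /mapP[A /sG GA ->]|]; first exact: map_f.
  apply: (can_inj hmxK); rewrite -hmx_prod => [|A /sG]; last exact: hG.
  by rewrite hmx0 -s1.
have wK : map hcoef (map hmx w) = w by rewrite mapK //; apply: hmxK.
exists (map hmx w); split; first by case: (w) w0.
  move=> A /mapP[g /wG/mapP[A' GA' ->] ->].
  by have [g' A'E] := hG _ GA'; rewrite A'E hmxK -A'E.
by rewrite hmx_prod ?wK ?w1 ?hmx0 // => A /mapP[g _ ->]; exists g.
Qed.

(** Positions in row-major order, with [n = m + 2]: [a] fills row 0 from column 1 on, [b] fills
    column [m+1] from row 1 on, and [c] is the entry in row 0 and column [m+1]. *)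
Definition coef_a c s r := dec_rat (cnth (cnth c s) r.+1).
Definition coef_b c s r := dec_rat (cnth (cnth c s) (r.+1 * n + m.+1)).
Definition coef_c c s := dec_rat (cnth (cnth c s) m.+1).

(** Row [s] of the linear system: [a], then [b], then the log at column [m + m]. Keeping only the
    first [m + m] columns leaves the equation on [u]. *)
Definition coef c s j :=
  if (j < m)%N then coef_a c s j
  else if (j < m + m)%N then coef_b c s (j - m)
  else coef_c c s - (\sum_(0 <= r < m) coef_a c s r * coef_b c s r) * 2%:R^-1.

Definition coef_comm c s t :=
  \sum_(0 <= r < m) coef_a c s r * coef_b c t r
  - \sum_(0 <= r < m) coef_a c t r * coef_b c s r.

Lemma recq_coef f g h : recf f -> recf g -> recf h ->
  recq (fun v => coef (f v) (g v) (h v)).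
Proof.
have rc : recq (fun v => coef (nth 0 v 0) (nth 0 v 1) (nth 0 v 2))%N.
  by rewrite /coef /coef_a /coef_b /coef_c; recur.
move=> rf rg rh.
exact: (recq_comp rc (recs_cons rf (recs_cons rg (recs_cons rh recs_nil)))).
Qed.

Lemma recq_coef_comm f g h : recf f -> recf g -> recf h ->
  recq (fun v => coef_comm (f v) (g v) (h v)).
Proof.
have rc : recq (fun v => coef_comm (nth 0 v 0) (nth 0 v 1) (nth 0 v 2))%N.
  by rewrite /coef_comm /coef_a /coef_b; recur.
move=> rf rg rh.
exact: (recq_comp rc (recs_cons rf (recs_cons rg (recs_cons rh recs_nil)))).
Qed.

Section Instance.

Variable G : seq 'M[rat]_n.
Let u s := (nth (0, 0) (map hcoef G) s).1.

Lemma csize_code : csize (mxs_code G) = size G.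
Proof. by rewrite /csize CodeSeq.codeK size_map. Qed.

Lemma cnth_code s : (s < size G)%N ->
  cnth (mxs_code G) s = mx_code (nth 0 G s).
Proof. by move=> lt_s; rewrite /cnth CodeSeq.codeK (nth_map 0). Qed.

Lemma coef_aE s (r : 'I_m) : (s < size G)%N ->
  coef_a (mxs_code G) s r = (u s).1 r 0.
Proof.
move=> lt_s; rewrite /u (nth_map 0) // mxE /coef_a cnth_code //.
rewrite -[r.+1]/(idx_first * n + idx_mid r)%N.
by rewrite cnth_mx_code rat_codeK.
Qed.

Lemma coef_bE s (r : 'I_m) : (s < size G)%N ->
  coef_b (mxs_code G) s r = (u s).2 r 0.
Proof.
move=> lt_s; rewrite /u (nth_map 0) // mxE /coef_b cnth_code //.
have -> : (r.+1 * n + m.+1 = idx_mid r * n + idx_last)%N.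
  by rewrite /= addn0.
by rewrite cnth_mx_code rat_codeK.
Qed.

Lemma coef_cE s : (s < size G)%N ->
  coef_c (mxs_code G) s = (nth (0, 0) (map hcoef G) s).2.
Proof.
move=> lt_s; rewrite (nth_map 0) // /coef_c cnth_code //.
have -> : m.+1 = (idx_first * n + idx_last)%N by rewrite /= addn0.
by rewrite cnth_mx_code rat_codeK.
Qed.

Lemma coef_logE s : (s < size G)%N ->
  coef (mxs_code G) s (m + m) = hlog cdot (nth (0, 0) (map hcoef G) s).
Proof.
move=> lt_s; rewrite /coef ltnn ltnNge leq_addr /= coef_cE // /hlog cdotE.
congr (_ - _ * _); rewrite big_mkord; apply: eq_bigr => r _.
by rewrite coef_aE // coef_bE.
Qed.

Lemma coef_commE s t : (s < size G)%N -> (t < size G)%N ->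
  coef_comm (mxs_code G) s t = hcomm cdot (u s) (u t).
Proof.
move=> lt_s lt_t; rewrite /coef_comm /hcomm !cdotE !big_mkord.
by congr (_ - _); apply: eq_bigr => r _; rewrite coef_aE // coef_bE.
Qed.

Lemma coef_kernel (x : nat -> nat) :
  (forall j, (j < m + m)%N ->
     \sum_(0 <= s < size G) (x s)%:R * coef (mxs_code G) s j = 0) <->
  \sum_(0 <= s < size G) u s *+ x s = 0.
Proof.
have fstE : (\sum_(0 <= s < size G) u s *+ x s).1 =
    \sum_(0 <= s < size G) (u s).1 *+ x s.
  rewrite (big_morph fst (id1 := 0) (id2 := 0) (fun _ _ => erefl) erefl).
  by apply: eq_bigr => s _; elim: (x s) => // k IHk; rewrite !mulrS -IHk.
have sndE : (\sum_(0 <= s < size G) u s *+ x s).2 =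
    \sum_(0 <= s < size G) (u s).2 *+ x s.
  rewrite (big_morph snd (id1 := 0) (id2 := 0) (fun _ _ => erefl) erefl).
  by apply: eq_bigr => s _; elim: (x s) => // k IHk; rewrite !mulrS -IHk.
have aE (r : 'I_m) :
    \sum_(0 <= s < size G) (x s)%:R * coef (mxs_code G) s r =
    (\sum_(0 <= s < size G) u s *+ x s).1 r 0.
  rewrite fstE summxE; apply: eq_big_nat => s lt_s.
  by rewrite /coef ltn_ord coef_aE // mulmxnE mulr_natl.
have bE (r : 'I_m) :
    \sum_(0 <= s < size G) (x s)%:R * coef (mxs_code G) s (m + r) =
    (\sum_(0 <= s < size G) u s *+ x s).2 r 0.
  rewrite sndE summxE; apply: eq_big_nat => s lt_s.
  rewrite /coef ltnNge leq_addr /= ltn_add2l ltn_ord addKn coef_bE //.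
  by rewrite mulmxnE mulr_natl.
split=> [x0|x0 j lt_j].
  rewrite [LHS]surjective_pairing; congr (_, _); apply/colP => r.
    by rewrite -aE x0 ?mxE // ltn_addr.
  by rewrite -bE x0 ?mxE // ltn_add2l.
have [lt_jm|le_mj] := ltnP j m.
  by have := aE (Ordinal lt_jm); rewrite x0 mxE.
have lt_jm : (j - m < m)%N by rewrite ltn_subLR.
by have := bE (Ordinal lt_jm); rewrite x0 mxE /= subnKC.
Qed.

Lemma supported_psiP i :
  supported (size G) (m + m) (coef (mxs_code G)) i <->
  exists2 x : nat -> nat, (0 < x i)%N & \sum_(0 <= s < size G) u s *+ x s = 0.
Proof. by split=> [] [x xi /coef_kernel x0]; exists x. Qed.

Lemma supported_logP i :
  supported (size G) (m + m).+1 (coef (mxs_code G)) i <->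
  exists2 x : nat -> nat, (0 < x i)%N &
    \sum_(0 <= s < size G) u s *+ x s = 0 /\
    \sum_(0 <= s < size G) hlog cdot (nth (0, 0) (map hcoef G) s) *+ x s = 0.
Proof.
have logE (x : nat -> nat) :
    \sum_(0 <= s < size G) hlog cdot (nth (0, 0) (map hcoef G) s) *+ x s =
    \sum_(0 <= s < size G) (x s)%:R * coef (mxs_code G) s (m + m).
  by apply: eq_big_nat => s lt_s; rewrite coef_logE // mulr_natl.
split=> [[x xi x0]|[x xi [/coef_kernel x0 xl]]]; exists x => //.
  by split; [apply/coef_kernel => j lt_j; apply/x0/ltnW | rewrite logE x0].
by move=> j; rewrite ltnS leq_eqVlt => /predU1P[->|/x0//]; rewrite -logE.
Qed.

End Instance.

Lemma heisenberg_identity_decidable :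
  decidable_problem (@mxs_code n)
    (fun G => {in G, forall A, exists g, A = hmx g})
    (fun G => in_semigroup G 1%:M).
Proof.
(* [D1] includes the log equation and serves the first alternative of [identity_wordP]; [D2] omits
   it and serves the second. *)
have [D1 rD1 D1P] := supported_decidable (m + m).+1 recq_coef.
have [D2 rD2 D2P] := supported_decidable (m + m) recq_coef.
pose ans c := has (fun i => D1 c i) (iota 0 (csize c)) ||
  has (fun i => has (fun j => [&& D2 c i, D2 c j & coef_comm c i j != 0])
     (iota 0 (csize c))) (iota 0 (csize c)).
have r_ans : recb (fun v => ans (head 0%N v)).
  have r_comm := recq_coef_comm.
  by rewrite /ans; recur.
exists (fun v => ans (head 0%N v)); split; first exact: r_ans.
move=> G hG /=; suff ansP : ans (mxs_code G) <-> in_semigroup G 1%:M.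
  by split=> [/ansP->|G1] //; case: (boolP (ans _)) => // /ansP.
have szG := csize_code G.
split=> [ansG|/(in_semigroup1P hG)].
  apply/(in_semigroup1P hG)/(identity_wordP cdotDl cdotDr); rewrite size_map.
  case/orP: ansG => /hasP[i]; rewrite mem_iota => lt_i.
    move/(D1P _ _ lt_i); rewrite szG in lt_i *; move/supported_logP.
    by left; exists i.
  case/hasP=> j; rewrite mem_iota => lt_j.
  case/and3P=> /(D2P _ _ lt_i) di /(D2P _ _ lt_j) dj ij.
  rewrite szG in lt_i lt_j di dj; rewrite coef_commE // in ij.
  by right; exists i, j; split=> //; apply/supported_psiP.
move/(identity_wordP cdotDl cdotDr); rewrite size_map.
case=> [[i [lt_i /supported_logP di]]|
        [i [j [lt_i lt_j ij /supported_psiP di /supported_psiP dj]]]].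
  apply/orP; left; apply/hasP; exists i; first by rewrite mem_iota szG.
  by apply/D1P; rewrite szG.
apply/orP; right; apply/hasP; exists i; first by rewrite mem_iota szG.
apply/hasP; exists j; first by rewrite mem_iota szG.
by apply/and3P; split; [apply/D2P | apply/D2P | rewrite coef_commE];
   rewrite ?szG.
Qed.

End Heisenberg.

Lemma heisenberg_hmx n m (e : (1 + (m + 1))%N = n) (A : 'M[rat]_n) :
  m = (n - 2)%N -> heisenberg A -> exists g, A = castmx (e, e) (hmx g).
Proof.
move=> mE; subst m => -[e' [a [b [c ->]]]].
by exists ((a, b), c); rewrite (eq_irrelevance e e').
Qed.
Local Close Scope ring_scope.

Theorem theorem18 (n : nat) (hn : 3 <= n) : identity_problem_decidable n.
Proof.
(* With [m] an independent variable, eliminating [e] replaces [n] by [1 + (m + 1)] and makes the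
   casts trivial. *)
have [m mE] : exists m, m = n - 2 by exists (n - 2).
have e : 1 + (m + 1) = n by lia.
move: mE (@heisenberg_hmx n m e); case: n / e {hn} => mE hmxP.
have [f [rf fP]] := heisenberg_identity_decidable m.
exists f; split=> // G hG; apply: fP => A /hG/(hmxP _ mE)[g ->].
by exists g; rewrite castmx_id.
Qed.
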